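(* Let $P$ be an atomized poset and let $k\geq 1$ be an integer such that no set of at most $k$ atoms of $P$ generates $P$ (i.e. every set of at most $k$ atoms has an upper bound in $P$). Then $|P|$ is $(k-2)$-connected. In particular, for any group $G$: (1) if $G$ cannot be generated by $k$ elements, then $|\mathcal{C}(G)|$ is $(k-1)$-connected; (2) if $G$ is a torsion group in which any $k$ elements of prime order generate a proper subgroup of $G$, then $|L(G)|$ is $(k-2)$-connected.
   Context: For a poset $P$, $|P|$ denotes the geometric realization of the order complex $\Delta(P)$, the simplicial complex whose simplices are the finite nonempty chains of $P$; topological notions for $P$ refer to $|P|$. A poset $P$ is atomized if every element of $P$ lies above some minimal element and every finite set of minimal elements that has an upper bound in $P$ has a join (least upper bound) in $P$. Minimal elements are called atoms. A finite set $S$ of atoms generates its join, and is said to generate $P$ if $S$ has no upper bound in $P$. For a group $G$, the coset poset $\mathcal{C}(G)$ is the set of all left cosets $xH$ ($x\in G$) of all proper subgroups $H<G$ (including the trivial subgroup), ordered by inclusion. The subgroup poset $L(G)$ is the set of proper nontrivial subgroups of $G$, ordered by inclusion. Convention: a space is $(-1)$-connected iff nonempty, every space is $(-2)$-connected, and the empty space is not $0$-connected. *)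

(* Defs.v *)
From mathcomp Require Import all_boot all_order all_algebra all_classical all_reals.
From mathcomp Require Import topology normedtype Rstruct Rstruct_topology.

Set Implicit Arguments.
Unset Strict Implicit.
Unset Printing Implicit Defensive.

Import Order.TTheory GRing.Theory Num.Theory.
Local Open Scope classical_set_scope.
Local Open Scope ring_scope.

Notation RR := Rdefinitions.R.

Definition is_poset (T : Type) (le : T -> T -> Prop) : Prop :=
  [/\ (forall x, le x x),
      (forall x y, le x y -> le y x -> x = y) &
      (forall x y z, le x y -> le y z -> le x z)].

Definition minimal (T : Type) (le : T -> T -> Prop) (a : T) : Prop :=
  forall y, le y a -> y = a.

Definition upper_bound (T : Type) (le : T -> T -> Prop) (s : seq T) (u : T) :=
  forall x, List.In x s -> le x u.

Definition is_join (T : Type) (le : T -> T -> Prop) (s : seq T) (j : T) :=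
  upper_bound le s j /\ forall u, upper_bound le s u -> le j u.

Definition atomized (T : Type) (le : T -> T -> Prop) : Prop :=
  (forall x, exists a, minimal le a /\ le a x) /\
  (forall s : seq T, s <> [::] -> (forall a, List.In a s -> minimal le a) ->
     (exists u, upper_bound le s u) -> exists j, is_join le s j).

Definition generates_poset (T : Type) (le : T -> T -> Prop) (s : seq T) :=
  (forall a, List.In a s -> minimal le a) /\ ~ (exists u, upper_bound le s u).

(* Geometric realization |P| of the order complex Delta(P).                 *)
(* Points: functions alpha : T -> R, nonnegative, whose support lies in a   *)
(* finite chain s, with sum 1 (barycentric coordinates).                    *)
(* Topology: the weak (coherent) topology: U is open iff its trace on each  *)
(* closed simplex (spanned by a finite chain) is open in the Euclidean      *)
(* topology of that simplex.                                                *)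

Definition is_chain (T : Type) (le : T -> T -> Prop) (s : seq T) : Prop :=
  forall x y, List.In x s -> List.In y s -> le x y \/ le y x.

Definition supported_in (T : Type) (alpha : T -> RR) (s : seq T) : Prop :=
  forall x, alpha x <> 0 -> List.In x s.

Definition realization (T : Type) (le : T -> T -> Prop) : set (T -> RR) :=
  [set alpha | (forall x, 0 <= alpha x) /\
     exists s : seq T, [/\ is_chain le s, List.NoDup s, supported_in alpha s &
                          \sum_(x <- s) alpha x = 1]].

Definition closed_simplex (T : Type) (le : T -> T -> Prop) (s : seq T)
  : set (T -> RR) :=
  [set alpha | realization le alpha /\ supported_in alpha s].

Definition coords (T : Type) (s : seq T) (alpha : T -> RR) : 'rV[RR]_(size s) :=
  \row_(i < size s) alpha (tnth (in_tuple s) i).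

Definition realization_open (T : Type) (le : T -> T -> Prop)
  (U : set (T -> RR)) : Prop :=
  U `<=` realization le /\
  forall s : seq T, is_chain le s ->
    exists V : set 'rV[RR]_(size s), open V /\
      forall alpha, closed_simplex le s alpha -> (U alpha <-> V (coords s alpha)).

Definition cont_into_realization (T : Type) (le : T -> T -> Prop) (m : nat)
  (A : set 'rV[RR]_m) (f : 'rV[RR]_m -> (T -> RR)) : Prop :=
  (forall v, A v -> realization le (f v)) /\
  forall U, realization_open le U ->
    exists O : set 'rV[RR]_m, open O /\ A `&` (f @^-1` U) = A `&` O.

Definition sqnorm (m : nat) (v : 'rV[RR]_m) : RR := \sum_(i < m) v ord0 i ^+ 2.
Definition sphere (m : nat) : set 'rV[RR]_m := [set v | sqnorm v = 1].
Definition ball_cl (m : nat) : set 'rV[RR]_m := [set v | sqnorm v <= 1].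

(* |P| is n-connected (n : int, n >= -2 meaningful): for every m with
   0 <= m <= n+1, every continuous map S^(m-1) -> |P| extends to a
   continuous map D^m -> |P|.  For m = 0 (S^(-1) empty, D^0 a point) this
   says |P| is nonempty; so (-1)-connected = nonempty, every space is
   (-2)-connected, and the empty space is not 0-connected.                 *)
Definition realization_connected (T : Type) (le : T -> T -> Prop) (n : int) :=
  forall m : nat, (m%:Z <= n + 1)%R ->
    forall f, cont_into_realization le (@sphere m) f ->
      exists g, cont_into_realization le (@ball_cl m) g /\
                forall v, sphere v -> g v = f v.

Definition is_group (G : Type) (mul : G -> G -> G) (one : G) (inv : G -> G) :=
  [/\ (forall x y z, mul x (mul y z) = mul (mul x y) z),
      (forall x, mul one x = x), (forall x, mul x one = x),
      (forall x, mul (inv x) x = one) & (forall x, mul x (inv x) = one)].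

Definition is_subgroup (G : Type) (mul : G -> G -> G) (one : G) (inv : G -> G)
  (H : set G) : Prop :=
  [/\ H one, (forall x y, H x -> H y -> H (mul x y)) & (forall x, H x -> H (inv x))].

Definition generates_group (G : Type) (mul : G -> G -> G) (one : G)
  (inv : G -> G) (s : seq G) : Prop :=
  forall H, is_subgroup mul one inv H -> (forall x, List.In x s -> H x) -> H = setT.

Definition gpow (G : Type) (mul : G -> G -> G) (one : G) (x : G) (n : nat) : G :=
  iter n (mul x) one.

Definition has_order (G : Type) (mul : G -> G -> G) (one : G) (x : G) (n : nat) :=
  (0 < n)%N /\ gpow mul one x n = one /\
  forall j, (0 < j)%N -> (j < n)%N -> gpow mul one x j <> one.

Definition torsion (G : Type) (mul : G -> G -> G) (one : G) : Prop :=
  forall x, exists n, has_order mul one x n.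

Definition prime_order (G : Type) (mul : G -> G -> G) (one : G) (x : G) :=
  exists p, prime p /\ has_order mul one x p.

Definition is_proper_coset (G : Type) (mul : G -> G -> G) (one : G)
  (inv : G -> G) (C : set G) : Prop :=
  exists x H, [/\ is_subgroup mul one inv H, H <> setT & C = [set mul x h | h in H]].

Definition coset_poset (G : Type) (mul : G -> G -> G) (one : G) (inv : G -> G) :=
  {C : set G | is_proper_coset mul one inv C}.

Definition coset_le (G : Type) (mul : G -> G -> G) (one : G) (inv : G -> G)
  (A B : coset_poset mul one inv) : Prop := proj1_sig A `<=` proj1_sig B.

Definition is_proper_nontrivial_subgroup (G : Type) (mul : G -> G -> G)
  (one : G) (inv : G -> G) (H : set G) : Prop :=
  [/\ is_subgroup mul one inv H, H <> setT & H <> [set one]].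

Definition subgroup_poset (G : Type) (mul : G -> G -> G) (one : G) (inv : G -> G) :=
  {H : set G | is_proper_nontrivial_subgroup mul one inv H}.

Definition subgroup_le (G : Type) (mul : G -> G -> G) (one : G) (inv : G -> G)
  (A B : subgroup_poset mul one inv) : Prop := proj1_sig A `<=` proj1_sig B.

(* Main.v *)
(** Choose an atom below each element. Given a map [f] from the sphere to |P|,
    its image is carried by finitely many elements of [P]. On a fine grid bump
    functions [lam v] of multiplicity at most [m + 1 <= k] on the ball, vertices
    near the sphere receive an element [pv v] of the carrier of [f] and every
    vertex receives an atom [av v]. The barycentric coordinates of the
    superlevel sets [t] of [v |-> lam v x] then yield a map to |P| that sends [t]
    to the join [J t] of at most [k] atoms: this is defined on the whole ball.
    Since [J t <= M t := max pv(t)] near the sphere, this map is joined to the one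
    given by [M], and the latter to the radial extension of [f] by a straight-line
    homotopy inside closed simplices. All three are packed into one finite
    family of weights whose positive members form a chain at every point, then
    normalised.
    The atoms of the coset poset are the points, and joins are intersections of
    upper bounds; [k + 1] points [x, x g_1, ..., x g_k] have an upper bound iff
    [g_1, ..., g_k] generate a proper subgroup. The atoms of the subgroup poset
    of a torsion group are the subgroups of prime order. *)

Require Import Defs.
From mathcomp Require Import all_boot all_order all_algebra all_classical all_reals.
From mathcomp Require Import topology normedtype Rstruct Rstruct_topology.
From mathcomp Require Import realfun lra ring zify.

Set Implicit Arguments.
Unset Strict Implicit.
Unset Printing Implicit Defensive.

Import Order.TTheory GRing.Theory Num.Theory.
Import numFieldNormedType.Exports.
Local Open Scope classical_set_scope.
Local Open Scope ring_scope.

Lemma In_mem (T : eqType) (s : seq T) x : List.In x s <-> x \in s.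
Proof.
elim: s => [|y s IH] //=; rewrite inE; split.
  by case=> [->|/IH ->]; rewrite ?eqxx ?orbT.
by case/orP => [/eqP ->|/IH]; [left|right].
Qed.

Lemma NoDup_uniq (T : eqType) (s : seq T) : List.NoDup s <-> uniq s.
Proof.
split.
  by elim=> //= x l xl _ ->; rewrite andbT; apply/negP => /In_mem.
elim: s => [_|x s IH] /=; first exact: List.NoDup_nil.
by case/andP => xs /IH us; apply: List.NoDup_cons => // /In_mem; apply/negP.
Qed.

(** * Continuity of real-valued functions *)

Section Continuity.
Variables (R : realType) (X : topologicalType).
Implicit Types f g : X -> R.

Definition pos (x : R) : R := Num.max 0 x.

Lemma pos_ge0 x : 0 <= pos x.
Proof. by rewrite /pos le_max lexx. Qed.

Lemma pos_gt0 x : (0 < pos x) = (0 < x).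
Proof. by rewrite /pos lt_max ltxx. Qed.

Lemma continuous_add f g : continuous f -> continuous g ->
  continuous (fun x => f x + g x).
Proof. by move=> cf cg x; exact: (@cvgD _ _ _ _ _ _ _ _ _ (cf x) (cg x)). Qed.

Lemma continuous_opp f : continuous f -> continuous (fun x => - f x).
Proof. by move=> cf x; exact: (@cvgN _ _ _ _ _ _ _ (cf x)). Qed.

Lemma continuous_mul f g : continuous f -> continuous g ->
  continuous (fun x => f x * g x).
Proof. by move=> cf cg x; exact: (@cvgM _ _ _ _ _ _ _ _ (cf x) (cg x)). Qed.

Lemma continuous_const (c : R) : continuous (fun _ : X => c).
Proof. by move=> x; exact: cvg_cst. Qed.

Lemma continuous_sum (I : Type) (r : seq I) (P : pred I) (F : I -> X -> R) :
  (forall i, P i -> continuous (F i)) ->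
  continuous (fun x => \sum_(i <- r | P i) F i x).
Proof. by apply: continuous_big; exact: add_continuous. Qed.

Lemma continuous_prod (I : Type) (r : seq I) (P : pred I) (F : I -> X -> R) :
  (forall i, P i -> continuous (F i)) ->
  continuous (fun x => \prod_(i <- r | P i) F i x).
Proof. by apply: continuous_big; exact: mul_continuous. Qed.

Lemma continuous_pos f : continuous f -> continuous (fun x => pos (f x)).
Proof.
move=> cf x; apply: (@continuous_max R X (fun _ => 0) f x); last exact: cf.
exact: cvg_cst.
Qed.

Lemma continuous_div f g x : continuous f -> continuous g -> g x != 0 ->
  {for x, continuous (fun y => f y / g y)}.
Proof.
move=> cf cg gx; apply: (@cvgM _ _ _ _ _ _ _ _ (cf x)).
exact: (@cvgV _ _ _ _ _ _ gx (cg x)).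
Qed.

Lemma continuous_at_mul f g x : {for x, continuous f} -> {for x, continuous g} ->
  {for x, continuous (fun y => f y * g y)}.
Proof. by move=> cf cg; exact: (@cvgM _ _ _ _ _ _ _ _ cf cg). Qed.

Lemma continuous_at_dist f x :
  (forall d, 0 < d -> \forall y \near x, `|f x - f y| < d) -> {for x, continuous f}.
Proof. by move=> fP; apply/cvgrPdist_lt. Qed.

Lemma near_gt0 f x : continuous f -> 0 < f x -> \forall y \near x, 0 < f y.
Proof. by move=> cf fx; exact: (cvgr_gt _ (cf x) _ fx). Qed.

End Continuity.

(** * Open sets of the realization and continuous maps given by weights *)

Section Realization.
Variables (T : eqType) (le : T -> T -> Prop).

(** Dropping the zero terms turns both lists into duplicate-free lists of the support, hence into
    permutations of each other. *)
Lemma sum_supported (a : T -> RR) (s t : seq T) : uniq s -> uniq t ->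
  supported_in a s -> supported_in a t -> \sum_(x <- s) a x = \sum_(x <- t) a x.
Proof.
move=> us ut as_ at_.
have drop0 u : \sum_(x <- u) a x = \sum_(x <- [seq x <- u | a x != 0]) a x.
  rewrite big_filter [LHS](bigID (fun x => a x != 0)) /=.
  by rewrite [X in _ + X]big1 ?addr0 // => x; rewrite negbK => /eqP.
rewrite (drop0 s) (drop0 t); apply: perm_big; apply: uniq_perm; rewrite ?filter_uniq //.
move=> x; rewrite !mem_filter; have [//|ax /=] := eqVneq (a x) 0.
by apply/idP/idP => _; apply/In_mem; [apply: at_|apply: as_]; apply/eqP.
Qed.

Lemma realization_supp_chain (a : T -> RR) x y : realization le a ->
  a x != 0 -> a y != 0 -> le x y \/ le y x.
Proof.
by move=> [_ [s [ch _ su _]]] /eqP ax /eqP ay; apply: ch; exact: su.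
Qed.

Lemma realization_sum (a : T -> RR) (t : seq T) : realization le a -> uniq t ->
  supported_in a t -> \sum_(x <- t) a x = 1.
Proof.
move=> [_ [s [_ /NoDup_uniq us su <-]]] ut at_.
by apply: sum_supported.
Qed.

(** Infinitely many coordinates may be constrained at once. On the simplex of a finite chain [s],
    the coordinates off [s] are 0, so their conditions are constant and only finitely many open
    conditions remain. *)
Lemma realization_open_prod (W : T -> set RR) : (forall p, open (W p)) ->
  realization_open le (realization le `&` [set a | forall p, W p (a p)]).
Proof.
move=> oW; split=> [a []//|s chs].
exists [set v : 'rV[RR]_(size s) | (forall p, p \notin s -> W p 0) /\
         forall i, W (tnth (in_tuple s) i) (v ord0 i)]; split; last first.
  move=> a [ra sa]; have a0 p : p \notin s -> a p = 0.
    by move=> ps; apply: contrapT => /sa/In_mem; exact/negP.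
  split=> [[_ Wa]|[W0 Wa]].
    by split=> [p ps|i]; [rewrite -(a0 p ps)|rewrite mxE].
  split=> // p; have [/tnthP[i ->]|/[dup] /a0 -> /W0//] := boolP (p \in in_tuple s).
  by have := Wa i; rewrite mxE.
rewrite openE => v [W0 Wv]; rewrite /interior.
near=> w; split=> //; near: w; apply: filter_forall => i.
apply: (@coord_continuous RR 1 (size s) ord0 i v).
by apply: open_nbhs_nbhs.
Unshelve. all: by end_near. Qed.

Section Family.
Variables (m : nat) (A : set 'rV[RR]_m) (I : finType) (e : I -> T).
Variable c : I -> 'rV[RR]_m -> RR.
Hypothesis c_cont : forall i, continuous (c i).
Hypothesis c_ge0 : forall i x, A x -> 0 <= c i x.
Hypothesis c_pos : forall x, A x -> exists i, 0 < c i x.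
Hypothesis c_chain : forall x i j, A x -> 0 < c i x -> 0 < c j x ->
  le (e i) (e j) \/ le (e j) (e i).

(** Distinct indices may carry the same element of the poset; their weights are then added before
    normalising. *)
Definition family_map (x : 'rV[RR]_m) (q : T) : RR :=
  (\sum_(i | e i == q) c i x) / \sum_i c i x.

Let tot_gt0 x : A x -> 0 < \sum_i c i x.
Proof.
move=> Ax; have [i ci] := c_pos Ax; rewrite (bigD1 i) //=.
by apply: ltr_wpDr => //; apply: sumr_ge0 => j _; exact: c_ge0.
Qed.

Let supp_i x i : A x -> (c i x != 0) = (0 < c i x).
Proof. by move=> Ax; rewrite lt0r c_ge0 // andbT. Qed.

Let fm_supp x (s : {set I}) : A x -> (forall i, 0 < c i x -> i \in s) ->
  supported_in (family_map x) [seq e i | i <- enum s].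
Proof.
move=> Ax xs q fq; apply/In_mem; apply: contrapT => qs.
apply: fq; rewrite /family_map big1 ?mul0r // => i /eqP eiq.
apply/eqP/negPn; rewrite supp_i //; apply/negP => /xs iS.
by apply: qs; apply/mapP; exists i; rewrite ?mem_enum.
Qed.

Let fm_realization x : A x -> realization le (family_map x).
Proof.
move=> Ax; split=> [q|].
  rewrite divr_ge0 ?(ltW (tot_gt0 Ax)) //.
  by apply: sumr_ge0 => i _; exact: c_ge0.
pose s := finset (fun i => 0 < c i x); have xs i : 0 < c i x -> i \in s by rewrite inE.
exists (undup [seq e i | i <- enum s]); split.
- move=> p q /In_mem; rewrite mem_undup => /mapP[i iS ->] /In_mem.
  rewrite mem_undup => /mapP[j jS ->].
  by apply: (c_chain Ax); [move: iS|move: jS]; rewrite mem_enum inE.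
- by apply/NoDup_uniq; exact: undup_uniq.
- by move=> q /(@fm_supp x s Ax xs)/In_mem qs; apply/In_mem; rewrite mem_undup.
rewrite -mulr_suml -[RHS](divff (lt0r_neq0 (tot_gt0 Ax))); congr (_ / _).
rewrite (exchange_big_dep xpredT) //=; apply: eq_bigr => i _.
have [ci|ci] := boolP (c i x == 0); first by rewrite (eqP ci) big1.
rewrite -big_filter (eq_filter (a2 := pred1 (e i))); last by move=> q; rewrite /= eq_sym.
rewrite filter_pred1_uniq ?undup_uniq ?big_seq1 // mem_undup.
by apply/mapP; exists i; rewrite // mem_enum inE -supp_i.
Qed.

(** The points near [x] are sorted by their set [s] of positive indices. Points with the same [s]
    are mapped into one closed simplex, where openness is Euclidean and coordinatewise continuity is
    enough. *)
Lemma family_map_cont : cont_into_realization le A family_map.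
Proof.
split=> [x|U oU]; first exact: fm_realization.
exists (interior [set y | A y -> U (family_map y)]); split; first exact: open_interior.
rewrite eqEsubset; split=> x [Ax]; last first.
  by move=> /interior_subset Ux; split=> //; exact: Ux.
move=> Ux; split=> //; rewrite /interior.
(* As [I] is finite there are finitely many [s], so one neighbourhood for each of them can be
   intersected. *)
suff H (s : {set I}) : \forall y \near x, A y -> s = finset (fun i => 0 < c i y) ->
    U (family_map y).
  have := filter_forall (nbhs_filter x) H.
  by apply: filterS => y Hy Ay; exact: (Hy _ Ay erefl).
(* An index positive at [x] stays positive nearby; if it lies outside [s], no nearby point of [A]
   has [s] as its positive set. *)
have [xs|] := pselect (forall i, 0 < c i x -> i \in s); last first.
  move/existsNP => [i /not_implyP [ci /negP iS]].
  have := near_gt0 (@c_cont i) ci; apply: filterS => y cy Ay sE.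
  by move: iS; rewrite sE inE cy.
pose l := [seq e i | i <- enum s].
have [chl|nch] := pselect (is_chain le l); last first.
  apply: (@filterE _ (nbhs x)) => y Ay sE; exfalso; apply: nch => p q.
  move=> /In_mem/mapP[i + ->] /In_mem/mapP[j + ->].
  by rewrite !mem_enum sE !inE; apply: c_chain.
have [V [oV UV]] := oU.2 l chl.
have Vx : V (coords l (family_map x)).
  by apply/UV => //; split; [exact: fm_realization|exact: fm_supp].
suff : \forall y \near x, V (coords l (family_map y)).
  apply: filterS => y Vy Ay sE; apply/UV => //; split; first exact: fm_realization.
  by apply: fm_supp => // i; rewrite sE inE.
have [P Pl sPV] : nbhs (coords l (family_map x)) V by apply: open_nbhs_nbhs.
suff H j : \forall y \near x, P ord0 j (family_map y (tnth (in_tuple l) j)).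
  have := filter_forall (nbhs_filter x) H.
  by apply: filterS => y Hy; apply: sPV => i j; rewrite mxE (ord1 i); exact: Hy.
have := Pl ord0 j; rewrite mxE.
have ct : {for x, continuous (fun y => family_map y (tnth (in_tuple l) j))}.
  apply: continuous_div; last by rewrite lt0r_neq0 ?tot_gt0.
    by apply: continuous_sum => k _.
  by apply: continuous_sum => k _.
exact: ct.
Unshelve. all: by end_near. Qed.

End Family.
End Realization.

(** * Maps from the sphere *)

Lemma continuous_coord m (i : 'I_m) : continuous (fun x : 'rV[RR]_m => x ord0 i).
Proof. exact: coord_continuous. Qed.

Lemma sqnorm_ge0 m (x : 'rV[RR]_m) : 0 <= sqnorm x.
Proof. by apply: sumr_ge0 => i _; exact: sqr_ge0. Qed.

Lemma sqnorm_continuous m : continuous (@sqnorm m).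
Proof.
apply: continuous_sum => i _; under eq_fun do rewrite expr2.
by apply: continuous_mul; exact: continuous_coord.
Qed.

Lemma sqnormZ m c (x : 'rV[RR]_m) : sqnorm (c *: x) = c ^+ 2 * sqnorm x.
Proof.
by rewrite /sqnorm mulr_sumr; apply: eq_bigr => i _; rewrite mxE exprMn.
Qed.

Lemma ball_cl_coord m (x : 'rV[RR]_m) i : ball_cl x -> -1 <= x ord0 i <= 1.
Proof.
rewrite /ball_cl /= /sqnorm (bigD1 i) //= => Bx.
have : 0 <= \sum_(j < m | j != i) x ord0 j ^+ 2.
  by apply: sumr_ge0 => j _; exact: sqr_ge0.
by move=> ?; apply/andP; split; nra.
Qed.

Lemma subcube_compact (R : realType) m (K : set 'rV[R]_m) :
  closed K -> (forall x, K x -> forall i, -1 <= x ord0 i <= 1) -> compact K.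
Proof.
move=> cK KB.
have cc : compact [set v : 'rV[R]_m | forall i, v ord0 i \in `[-1, 1]].
  by apply: (@rV_compact _  _ (fun=> `[(-1 : R), 1]%classic)) => _; exact: segment_compact.
by apply: subclosed_compact cK cc _ => v /KB Bv i; rewrite in_itv /=.
Qed.

Lemma closed_sqnorm m (a b : RR) :
  closed [set x : 'rV[RR]_m | a <= sqnorm x <= b].
Proof.
have -> : [set x : 'rV[RR]_m | a <= sqnorm x <= b] = @sqnorm m @^-1` `[a, b].
  by apply/seteqP; split=> x /=; rewrite in_itv.
apply: closed_comp => [x _|]; first exact: sqnorm_continuous.
exact: interval_closed.
Qed.

Lemma annulus_compact m (a : RR) : 
  compact [set x : 'rV[RR]_m | a <= sqnorm x <= 1].
Proof.
apply: subcube_compact; first exact: closed_sqnorm.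
by move=> x /andP[_ Bx] i; exact: ball_cl_coord.
Qed.

Lemma sphere_compact m : compact (@sphere m).
Proof.
have -> : @sphere m = [set x | 1 <= sqnorm x <= 1]; last exact: annulus_compact.
by apply/seteqP; split=> x /=; rewrite -eq_le eq_sym => /eqP.
Qed.

(** A Lebesgue number, for the sup distance, of the cover of [K] by the open sets on which some
    [h i] is positive. *)
Lemma lebesgue_pos m (I : finType) (h : I -> 'rV[RR]_m -> RR) (K : set 'rV[RR]_m) :
  compact K -> (forall i, continuous (h i)) ->
  (forall x, K x -> exists i, 0 < h i x) ->
  exists2 d : RR, 0 < d & forall x, K x -> exists i,
    forall y : 'rV[RR]_m, (forall j, `|x ord0 j - y ord0 j| < d) -> 0 < h i y.
Proof.
move=> /compact_near_coveringP cK ch hpos.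
pose P (d : RR) (x : 'rV[RR]_m) := exists i, forall y : 'rV[RR]_m, ball x d y -> 0 < h i y.
have : \forall d \near (0 : RR)^'+, K `<=` P d.
  apply: cK => x /hpos[i hi].
  have /nbhs_ballP[e /= e0 he] := near_gt0 (ch i) hi.
  (* Half of [e] pays for the move from [x] to [x'], the other half for the ball of radius [d] about
     [x']. *)
  exists (ball x (e / 2), [set d | d < e / 2]) => /=.
    split; first by apply: nbhsx_ballx; rewrite divr_gt0.
    by apply: nbhs_right_lt; rewrite divr_gt0.
  move=> [x' d] /= [xx' de]; exists i => y x'y; apply: he.
  apply: (ball_split xx'); apply: le_ball x'y; exact: ltW.
move=> H; have [d [d0 dP]] : exists d : RR, 0 < d /\ K `<=` P d.
  have := @filter_ex _ (0 : RR)^'+ _ _ (filterI (nbhs_right_gt 0) H).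
  by case=> d [? ?]; exists d.
exists d => // x /dP[i hi]; exists i => y xy; apply: hi.
split=> // j k.
by rewrite (ord1 j); exact: xy.
Qed.

Section SphereMap.
Variables (T : choiceType) (le : T -> T -> Prop) (m : nat).
Variable f : 'rV[RR]_m -> T -> RR.
Hypothesis cf : cont_into_realization le (@sphere m) f.

Lemma realization_ge0 (a : T -> RR) p : realization le a -> 0 <= a p.
Proof. by case. Qed.

Lemma realization_le1 (a : T -> RR) p : realization le a -> a p <= 1.
Proof.
move=> [a0 [s [_ /NoDup_uniq us su <-]]].
have [ps|ps] := boolP (p \in s).
  by rewrite (big_rem p) //= lerDl sumr_ge0.
suff -> : a p = 0 by apply: sumr_ge0.
by apply: contrapT => /su/In_mem; exact/negP.
Qed.

Lemma continuous_scale (R : realType) (X : topologicalType) n (k : X -> R)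
    (g : X -> 'rV[R]_n) x :
  {for x, continuous k} -> {for x, continuous g} ->
  {for x, continuous (fun y => k y *: g y)}.
Proof. by move=> ck cg; apply: (@cvgZ _ _ _ _ _ k g _ _ ck cg). Qed.

Lemma sqrt_inv_continuous (R : realType) (X : topologicalType) (q : X -> R) x :
  continuous q -> 0 < q x -> {for x, continuous (fun y => (Num.sqrt (q y))^-1)}.
Proof.
move=> cq qx; have sx : Num.sqrt (q x) != 0 by rewrite gt_eqF // sqrtr_gt0.
apply: (@cvgV _ _ _ _ (fun y => Num.sqrt (q y)) _ sx).
apply: (@continuous_comp _ _ _ q Num.sqrt x); first exact: cq.
exact: sqrt_continuous.
Qed.

Lemma open_dist (R : realType) (c d : R) : open [set r : R | `|c - r| < d].
Proof. exact: (@ball_open R R^o c d). Qed.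

Lemma sphere_map_near (W : T -> set RR) x : sphere x -> (forall p, open (W p)) ->
  (forall p, W p (f x p)) ->
  exists O : set 'rV[RR]_m, [/\ open O, O x &
    forall y, sphere y -> O y -> forall p, W p (f y p)].
Proof.
move=> Sx oW Wx; have [O [oO fO]] := cf.2 _ (realization_open_prod le oW).
exists O; split=> //.
  have : (@sphere m `&` O) x; last by case.
  by rewrite -fO; split=> //; split=> //; exact: cf.1.
move=> y Sy Oy; have : (@sphere m `&` O) y by [].
by rewrite -fO => -[_ []].
Qed.

(** A compact set meets only finitely many vertices. Each list [L] defines the open condition that
    every coordinate [p] off [L] stays below a threshold [e p]; these conditions cover the sphere,
    and the lists of a finite subcover are concatenated. *)
Lemma sphere_map_finite_support :
  exists2 F : seq T, uniq F & forall x, sphere x -> supported_in (f x) F.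
Proof.
(* The threshold is a positive value attained by coordinate [p], or 1 if that coordinate vanishes on
   the whole sphere. *)
have /choice[e eP] : forall p, exists r : RR, 0 < r /\
    ((exists2 x, sphere x & f x p != 0) -> exists2 x, sphere x & r <= f x p).
  move=> p; have [[x Sx fx]|nx] := pselect (exists2 x, sphere x & f x p != 0).
    exists (f x p); split=> [|_]; last by exists x.
    by rewrite lt0r fx /= (realization_ge0 p (cf.1 _ Sx)).
  by exists 1; split.
pose W (L : seq T) p := [set r : RR | p \in L \/ r < e p].
have oW L p : open (W L p).
  have [pL|pL] := boolP (p \in L).
    have -> : W L p = setT by apply/seteqP; split=> // r _; left.
    exact: openT.
  have -> : W L p = [set r | r < e p]; last exact: open_lt.
  by apply/seteqP; split=> r; [case=> // pL'; rewrite pL' in pL|right].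
pose O L := \bigcup_(V in [set V : set 'rV[RR]_m | open V /\
   forall y, sphere y -> V y -> forall p, W L p (f y p)]) V.
have := @sphere_compact m; rewrite compact_cover.
move=> /(_ (seq T : choiceType) setT O).
case=> [L _|x Sx|D _ DO].
- by apply: bigcup_open => V [].
- have [_ [s [_ _ su _]]] := cf.1 _ Sx; exists s => //.
  have [|V [oV Vx HV]] := @sphere_map_near (W s) x Sx (oW s); last by exists V.
  move=> p; have [|ps] := boolP (p \in s); first by left.
  right; suff -> : f x p = 0 by case: (eP p).
  by apply: contrapT => /su/In_mem; exact/negP.
exists (undup (flatten (finmap.enum_fset D))); first exact: undup_uniq.
move=> x Sx p /eqP fx; apply/In_mem; rewrite mem_undup.
(* The cover is used at [y], where coordinate [p] reaches its threshold: this forces [p] into the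
   list covering [y]. *)
have [_ [|y Sy efy]] := eP p; first by exists x.
have [L /= LD [V [_ HV] Vy]] := DO y Sy.
apply/flattenP; exists L => //.
by have [//|] := HV y Sy Vy p; rewrite ltNge efy.
Qed.

Definition radial_proj (x : 'rV[RR]_m) := (Num.sqrt (sqnorm x))^-1 *: x.

Lemma radial_proj_sphere x : 0 < sqnorm x -> sphere (radial_proj x).
Proof.
move=> qx; rewrite /sphere /= sqnormZ exprVn sqr_sqrtr ?sqnorm_ge0 //.
by rewrite mulVf // gt_eqF.
Qed.

Lemma radial_proj_id x : sphere x -> radial_proj x = x.
Proof. by rewrite /sphere /radial_proj /= => ->; rewrite sqrtr1 invr1 scale1r. Qed.

Lemma radial_proj_continuous x : 0 < sqnorm x -> {for x, continuous radial_proj}.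
Proof.
move=> qx; apply: continuous_scale; last exact: cvg_id.
by apply: sqrt_inv_continuous => //; exact: sqnorm_continuous.
Qed.

(** The factor [sqnorm x] makes the radial extension of coordinate [p] continuous at the origin,
    where [radial_proj] only has a default value. *)
Definition cone_coord p (x : 'rV[RR]_m) : RR := sqnorm x * f (radial_proj x) p.

Lemma cone_coord_ge0 p x : 0 <= cone_coord p x.
Proof.
have [q0|qx] := eqVneq (sqnorm x) 0; first by rewrite /cone_coord q0 mul0r.
rewrite mulr_ge0 ?sqnorm_ge0 // (realization_ge0 p) //; apply: cf.1.
by apply: radial_proj_sphere; rewrite lt0r qx sqnorm_ge0.
Qed.

Lemma cone_coord_gt0 p x : 0 < cone_coord p x -> 0 < sqnorm x /\ f (radial_proj x) p != 0.
Proof.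
rewrite /cone_coord => H; split.
  by rewrite lt0r sqnorm_ge0 andbT; apply/eqP => q0; rewrite q0 mul0r ltxx in H.
by apply/eqP => q0; rewrite q0 mulr0 ltxx in H.
Qed.

(** At the origin, the bound by [sqnorm] suffices, since barycentric coordinates are at most 1.
    Elsewhere [f] is composed with the radial projection, using an open condition on coordinate [p]
    alone. *)
Lemma cone_coord_continuous p : continuous (cone_coord p).
Proof.
move=> x; have [q0|qx] := eqVneq (sqnorm x) 0.
  apply: continuous_at_dist => e e0.
  have hx0 : cone_coord p x = 0 by rewrite /cone_coord q0 mul0r.
  have : \forall y \near x, 0 < e - sqnorm y.
    apply: near_gt0; last by rewrite q0 subr0.
    apply: continuous_add; first exact: continuous_const.
    by apply: continuous_opp; exact: sqnorm_continuous.
  apply: filterS => y qe; rewrite hx0 sub0r normrN ger0_norm ?cone_coord_ge0 //.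
  apply: (@le_lt_trans _ _ (sqnorm y)); last by rewrite -subr_gt0.
  have [q0'|qy] := eqVneq (sqnorm y) 0; first by rewrite /cone_coord q0' mul0r.
  rewrite /cone_coord ler_piMr ?sqnorm_ge0 // realization_le1 //; apply: cf.1.
  by apply: radial_proj_sphere; rewrite lt0r qy sqnorm_ge0.
have {}qx : 0 < sqnorm x by rewrite lt0r qx sqnorm_ge0.
apply: continuous_at_mul; first exact: sqnorm_continuous.
apply: continuous_at_dist => e e0.
pose W p' := if p' == p then [set r : RR | `|f (radial_proj x) p - r| < e] else setT.
have [p'|p'|O [oO Ox HO]] := @sphere_map_near W (radial_proj x) (radial_proj_sphere qx).
- rewrite /W; case: ifP => _; last exact: openT.
  exact: open_dist.
- by rewrite /W; case: ifP => // /eqP -> /=; rewrite subrr normr0.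
have /(radial_proj_continuous qx) : nbhs (radial_proj x) O by apply: open_nbhs_nbhs.
have := near_gt0 (@sqnorm_continuous m) qx.
apply: filterS2 => y qy Oy.
by have := HO _ (radial_proj_sphere qy) Oy p; rewrite /W eqxx.
Qed.

End SphereMap.

(** * Grid bump functions *)

Lemma prod_gt0P (R : realType) (I : finType) (P : pred I) (F : I -> R) :
  (forall i, 0 <= F i) ->
  (0 < \prod_(i | P i) F i) <-> (forall i, P i -> 0 < F i).
Proof.
move=> F0; split=> [|H]; last exact: prodr_gt0.
rewrite lt0r => /andP[/prodf_neq0 H _] i Pi.
by rewrite lt0r F0 andbT; exact: H.
Qed.

Section Grid.
Variables (m N : nat).
Implicit Types (v w : {ffun 'I_m -> 'I_(N.*2.+1)}) (x y : 'rV[RR]_m).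

(** The cube with coordinates in [-1, 1] is rescaled to [0, 2N]; this is the displacement of the
    rescaled point from the integer vertex [v]. *)
Definition grid_disp v x i : RR := N%:R * x ord0 i + N%:R - (v i : nat)%:R.

(* The support of [grid_bump v] is the open star of the vertex [v] in the
   Freudenthal triangulation, which keeps the multiplicity down to [m + 1]. *)
Definition grid_bump v x : RR :=
  (\prod_i \prod_j pos (1 - (grid_disp v x i - grid_disp v x j))) *
  \prod_i (pos (1 - grid_disp v x i) * pos (1 + grid_disp v x i)).

Lemma grid_bump_ge0 v x : 0 <= grid_bump v x.
Proof.
apply: mulr_ge0; apply: prodr_ge0 => i _; last by rewrite mulr_ge0 ?pos_ge0.
by apply: prodr_ge0 => j _; exact: pos_ge0.
Qed.

Lemma grid_bump_gt0 v x : 0 < grid_bump v x <->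
  (forall i j, grid_disp v x i - grid_disp v x j < 1) /\
  (forall i, -1 < grid_disp v x i < 1).
Proof.
have p0 (r : RR) : 0 <= pos r by exact: pos_ge0.
rewrite /grid_bump mulr_ge0_gt0; first last.
- by apply: prodr_ge0 => i _; rewrite mulr_ge0.
- by apply: prodr_ge0 => i _; apply: prodr_ge0.
split.
  case/andP => /prod_gt0P H1 /prod_gt0P H2; split=> [i j|i].
    have /prod_gt0P := H1 (fun i => ltac:(by apply: prodr_ge0)) i isT.
    by move/(_ (fun=> p0 _) j isT); rewrite pos_gt0 subr_gt0.
  have := H2 (fun=> mulr_ge0 (p0 _) (p0 _)) i isT.
  rewrite mulr_ge0_gt0 // !pos_gt0 => /andP[? ?]; apply/andP; split; lra.
case=> H1 H2; apply/andP; split; apply: prodr_gt0 => i _.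
  by apply: prodr_gt0 => j _; rewrite pos_gt0 subr_gt0.
by have /andP[? ?] := H2 i; rewrite mulr_gt0 // pos_gt0; lra.
Qed.

Lemma grid_bump_continuous v : continuous (grid_bump v).
Proof.
have cd i : continuous (fun x => grid_disp v x i).
  apply: continuous_add; last exact: continuous_const.
  apply: continuous_add; last exact: continuous_const.
  by apply: continuous_mul; [exact: continuous_const|exact: continuous_coord].
have c1 : continuous (fun _ : 'rV[RR]_m => 1 : RR) by exact: continuous_const.
apply: continuous_mul; apply: continuous_prod => i _.
  apply: continuous_prod => j _; apply/continuous_pos/continuous_add => //.
  by apply/continuous_opp/continuous_add => //; exact/continuous_opp.
apply: continuous_mul; apply/continuous_pos/continuous_add => //.
exact/continuous_opp.
Qed.

(** Rounding the rescaled coordinates down gives a vertex whose displacements all lie in [0, 1), so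
    their differences are below 1. *)
Lemma grid_bump_cover x : ball_cl x -> exists v, 0 < grid_bump v x.
Proof.
move=> Bx.
have y0 i : 0 <= N%:R * x ord0 i + N%:R.
  have /andP[x1 _] := ball_cl_coord i Bx; have : 0 <= N%:R :> RR by []; nra.
have lt i : (Num.truncn (N%:R * x ord0 i + N%:R) < N.*2.+1)%N.
  have /andP[_ x1] := ball_cl_coord i Bx; have N0 : 0 <= N%:R :> RR by [].
  have /andP[le _] := truncn_itv (y0 i).
  rewrite ltnS -(ler_nat RR); apply: le_trans le _.
  rewrite -addnn natrD; nra.
exists [ffun i => Ordinal (lt i)]; apply/grid_bump_gt0.
have H i : 0 <= grid_disp [ffun i => Ordinal (lt i)] x i < 1.
  rewrite /grid_disp ffunE /=; have := truncn_itv (y0 i).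
  by rewrite -natr1 => /andP[? ?]; apply/andP; split; lra.
by split=> [i j|i]; have /andP[? ?] := H i; [have /andP[? ?] := H j|]; lra.
Qed.

Lemma grid_bump_local v x y i : 0 < grid_bump v x -> 0 < grid_bump v y ->
  N%:R * `|x ord0 i - y ord0 i| < 2.
Proof.
move=> /grid_bump_gt0[_ /(_ i)+] /grid_bump_gt0[_ /(_ i)].
rewrite /grid_disp => /andP[? ?] /andP[? ?].
by rewrite -[N%:R]ger0_norm // -normrM ltr_norml; apply/andP; split; lra.
Qed.

(* Vertices active at a common point form a chain for the product order, of
   total height at most [m]. *)
Lemma grid_bump_mult x (s : {set {ffun 'I_m -> 'I_(N.*2.+1)}}) :
  (forall v, v \in s -> 0 < grid_bump v x) -> (#|s| <= m.+1)%N.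
Proof.
move=> sP; have [->|[v0 v0s]] := set_0Vmem s; first by rewrite cards0.
(* If [v] exceeds [w] at [i] and [w] exceeds [v] at [j], two displacement differences, each below 1,
   have a sum of at least 2. *)
have comp v w : v \in s -> w \in s ->
    (forall i, (v i <= w i)%N) \/ (forall i, (w i <= v i)%N).
  move=> /sP/grid_bump_gt0[vd _] /sP/grid_bump_gt0[wd _].
  have [|] := pselect (forall i, (v i <= w i)%N); first by left.
  move=> /existsNP[i /negP]; rewrite -ltnNge => wvi; right=> j.
  rewrite leqNgt; apply/negP => vwj.
  have := vd j i; have := wd i j; rewrite /grid_disp.
  have arith (a b c d X Y : RR) : a + 1 <= b -> c + 1 <= d ->
      X - a - (Y - d) < 1 -> Y - c - (X - b) < 1 -> False.
    by move=> *; lra.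
  by move: wvi vwj; rewrite -2!(ler_nat RR) -!natr1; exact: arith.
have close v w i : v \in s -> w \in s -> (w i <= (v i).+1)%N.
  move=> /sP/grid_bump_gt0[_ /(_ i)/andP[_ vd]] /sP/grid_bump_gt0[_ /(_ i)/andP[wd _]].
  rewrite leqNgt; apply/negP; rewrite -(ler_nat RR) -!natr1.
  have arith (a b X : RR) : -1 < X - b -> X - a < 1 -> a + 1 + 1 <= b -> False.
    by move=> *; lra.
  by move: wd vd; rewrite /grid_disp; exact: arith.
(* On a chain for the product order the coordinate sum is injective. *)
pose ht v := (\sum_i v i)%N.
have ht_inj v w : v \in s -> w \in s -> ht v = ht w -> v = w.
  move=> vs ws; wlog vw : v w vs ws / forall i, (v i <= w i)%N => [H|] hvw.
    by have [vw|wv] := comp v w vs ws; [exact: H|apply/esym/H].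
  apply/ffunP => i; apply/val_inj => /=.
  have := leqif_sum (fun i (_ : true) => leqif_eq (vw i)).
  by rewrite -/(ht v) -/(ht w) => -[_]; rewrite hvw eqxx => /esym/forallP/(_ i)/eqP.
case: (arg_minnP ht v0s) => u us umin.
(* Each of the [m] coordinates rises by at most 1 above the lowest vertex [u]. *)
have hle v : v \in s -> (ht v - ht u < m.+1)%N.
  move=> vs; rewrite ltnS leq_subLR.
  have [uv|vu] := comp u v us vs; last first.
    by apply: leq_trans (leq_addr _ _); apply: leq_sum => i _.
  apply: (@leq_trans (\sum_(i < m) (u i).+1)%N).
    by apply: leq_sum => i _; exact: close.
  rewrite (eq_bigr (fun i => (u i + 1)%N)) => [|i _]; last by rewrite addn1.
  by rewrite big_split /= sum1_card card_ord.
have inj : {in s &, injective (fun v => inord (ht v - ht u) : 'I_m.+1)}.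
  move=> v w vs ws /(congr1 (@nat_of_ord _)) /=; rewrite !inordK ?hle // => /eqP.
  by rewrite eqn_sub2rE ?umin // => /eqP; exact: ht_inj.
by rewrite -(card_in_imset inj) -[leqRHS]card_ord; exact: max_card.
Qed.

End Grid.

(** * Extension to the ball *)

Section Chains.
Variables (T : eqType) (le : T -> T -> Prop).

Lemma chain_max (s : seq T) : is_poset le -> s != [::] ->
  {in s &, forall x y, le x y \/ le y x} -> exists2 u, u \in s & {in s, forall x, le x u}.
Proof.
case=> refl _ trans; elim: s => // x s IH _ ch.
have [->|sN] := eqVneq s [::].
  by exists x; rewrite ?mem_head // => y; rewrite inE => /eqP ->.
have [y z ys zs|u us umax] := IH sN.
  by apply: ch; rewrite inE ?ys ?zs orbT.
have := ch x u (mem_head _ _); rewrite inE us orbT => /(_ isT)[xu|ux].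
  by exists u; rewrite ?inE ?us ?orbT // => y /orP[/eqP -> //|/umax].
exists x; rewrite ?mem_head // => y; rewrite inE => /orP[/eqP -> //|/umax yu].
exact: trans yu ux.
Qed.

End Chains.

Section Extension.
Variables (T : choiceType) (le : T -> T -> Prop) (m k : nat) (V : finType).
Hypothesis le_poset : is_poset le.
Variable f : 'rV[RR]_m -> T -> RR.
Hypothesis f_sphere : forall x, sphere x -> realization le (f x).
Variable F : seq T.
Hypothesis F_uniq : uniq F.
Hypothesis F_supp : forall x, sphere x -> supported_in (f x) F.
Hypothesis cone_cont : forall p, continuous (cone_coord f p).
Hypothesis cone_ge0 : forall p x, 0 <= cone_coord f p x.
Variable lam : V -> 'rV[RR]_m -> RR.
Hypothesis lam_cont : forall v, continuous (lam v).
Hypothesis lam_ge0 : forall v x, 0 <= lam v x.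
Hypothesis lam_cover : forall x, ball_cl x -> exists v, 0 < lam v x.
Hypothesis lam_mult : forall x (s : {set V}),
  (forall v, v \in s -> 0 < lam v x) -> (#|s| <= k)%N.
(* [pv] is a simplicial approximation of the radial extension of [f], needed
   only on the annulus [1/4 < sqnorm x <= 1]. *)
Variables pv av : V -> T.
Hypothesis pv_star : forall v x, ball_cl x -> 1/4 < sqnorm x -> 0 < lam v x ->
  f (radial_proj x) (pv v) != 0.
Hypothesis av_pv : forall v, le (av v) (pv v).
Variables J M : {set V} -> T.
Hypothesis J_join : forall t : {set V}, t != finset.set0 -> (#|t| <= k)%N ->
  is_join le [seq av v | v <- enum t] (J t).
Hypothesis M_max : forall t : {set V},
  (exists2 v, v \in t & forall w, w \in t -> le (pv w) (pv v)) ->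
  exists2 v, v \in t & M t = pv v /\ forall w, w \in t -> le (pv w) (M t).

Implicit Types (x : 'rV[RR]_m) (t : {set V}).

(** Positive exactly where all values of [lam] on [t] exceed those off [t], as for barycentric
    subdivision coordinates. The threshold [lvl] is 0 while [sqnorm x] is at most 1/4 and rises to
    3/4 on the sphere. *)
Let sep t x := \prod_(v in t) \prod_(w in ~: t) pos (lam v x - lam w x).
Let lvl x := pos (sqnorm x - 1/4).

(* The weights of [M t] and [J t] are positive only for superlevel sets [t] of
   [v |-> lam v x], at a level below, respectively above, [lvl x]. *)
Definition ext_weight (i : 'I_(size F) + ({set V} + {set V})) x : RR :=
  match i with
  | inl p => pos (sqnorm x - 1/2) * cone_coord f (tnth (in_tuple F) p) x
  | inr (inl t) => (t != finset.set0)%:R * (pos (1 - sqnorm x) * (lvl x *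
      (sep t x * (\prod_(v in t) lam v x * \prod_(w in ~: t) pos (lvl x - lam w x)))))
  | inr (inr t) => (t != finset.set0)%:R * (pos (1/2 - sqnorm x) *
      (sep t x * \prod_(v in t) pos (lam v x - lvl x)))
  end.

Definition ext_elt (i : 'I_(size F) + ({set V} + {set V})) : T :=
  match i with
  | inl p => tnth (in_tuple F) p
  | inr (inl t) => M t
  | inr (inr t) => J t
  end.

Let sep_ge0 t x : 0 <= sep t x.
Proof. by do 2![apply: prodr_ge0 => ? _]; exact: pos_ge0. Qed.

Let sep_gt0 t x : 0 < sep t x <->
  forall v w, v \in t -> w \notin t -> lam w x < lam v x.
Proof.
split=> [/prod_gt0P H v w vt wt|H].
  have /prod_gt0P := H (fun v => ltac:(by apply: prodr_ge0 => ? _; exact: pos_ge0)) v vt.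
  by move/(_ (fun=> pos_ge0 _) w); rewrite inE wt pos_gt0 subr_gt0; exact.
apply: prodr_gt0 => v vt; apply: prodr_gt0 => w; rewrite inE => wt.
by rewrite pos_gt0 subr_gt0; exact: H.
Qed.

Lemma ext_weight_ge0 i x : 0 <= ext_weight i x.
Proof.
have p0 (I : finType) (P : pred I) (G : I -> RR) : 0 <= \prod_(i | P i) pos (G i).
  by apply: prodr_ge0 => ? _; exact: pos_ge0.
case: i => [p|[t|t]] /=; first by rewrite mulr_ge0 ?pos_ge0.
  by rewrite !mulr_ge0 ?pos_ge0 ?sep_ge0 ?p0 //; apply: prodr_ge0.
by rewrite !mulr_ge0 ?pos_ge0 ?sep_ge0 ?p0.
Qed.

Let weightM_gt0 t x : 0 < ext_weight (inr (inl t)) x <->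
  [/\ t != finset.set0, sqnorm x < 1 /\ 1/4 < sqnorm x,
      forall v w, v \in t -> w \notin t -> lam w x < lam v x,
      forall v, v \in t -> 0 < lam v x &
      forall w, w \notin t -> lam w x < sqnorm x - 1/4].
Proof.
have p0 : 0 <= \prod_(w in ~: t) pos (lvl x - lam w x).
  by apply: prodr_ge0 => ? _; exact: pos_ge0.
have l0 : 0 <= \prod_(v in t) lam v x by apply: prodr_ge0.
rewrite /= !mulr_ge0_gt0 ?mulr_ge0 ?pos_ge0 ?sep_ge0 //.
rewrite ltr0n lt0b !pos_gt0 !subr_gt0; split.
  case/and5P => t0 q1 q2 /sep_gt0 st /andP[/prod_gt0P lt /prod_gt0P wt].
  split=> //; first by apply: lt.
  move=> w wt'; have := wt (fun=> pos_ge0 _) w; rewrite inE wt' => /(_ isT).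
  by rewrite pos_gt0 subr_gt0 /lvl /pos maxEle ltW // subr_gt0.
case=> -> [-> q2] /sep_gt0 -> lt wt /=; rewrite q2 prodr_gt0 //=.
apply: prodr_gt0 => w; rewrite inE => /wt H.
by rewrite pos_gt0 subr_gt0 /lvl /pos maxEle ltW // subr_gt0.
Qed.

Let weightJ_gt0 t x : 0 < ext_weight (inr (inr t)) x <->
  [/\ t != finset.set0, sqnorm x < 1/2,
      forall v w, v \in t -> w \notin t -> lam w x < lam v x &
      forall v, v \in t -> lvl x < lam v x].
Proof.
have p0 : 0 <= \prod_(v in t) pos (lam v x - lvl x).
  by apply: prodr_ge0 => ? _; exact: pos_ge0.
rewrite /= !mulr_ge0_gt0 ?mulr_ge0 ?pos_ge0 ?sep_ge0 //.
rewrite ltr0n lt0b !pos_gt0 !subr_gt0; split.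
  case/and4P => t0 q1 /sep_gt0 st /prod_gt0P lt.
  by split=> // v vt; have := lt (fun=> pos_ge0 _) v vt; rewrite pos_gt0 subr_gt0.
case=> -> -> /sep_gt0 -> lt /=; apply: prodr_gt0 => v /lt H.
by rewrite pos_gt0 subr_gt0.
Qed.

(** Elements of both set differences would satisfy two opposite strict inequalities. *)
Let superlevel_comparable x t t' :
  (forall v w, v \in t -> w \notin t -> lam w x < lam v x) ->
  (forall v w, v \in t' -> w \notin t' -> lam w x < lam v x) ->
  t \subset t' \/ t' \subset t.
Proof.
move=> H H'; have [|/subsetPn[v vt vt']] := boolP (t \subset t'); first by left.
right; apply/fintype.subsetP => w wt'; apply: contrapT => /negP wt.
by have := lt_trans (H v w vt wt) (H' w v wt' vt'); rewrite ltxx.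
Qed.

Let J_mono t t' : t != finset.set0 -> (#|t'| <= k)%N -> t \subset t' -> le (J t) (J t').
Proof.
move=> t0 t'k tt'; have t'0 : t' != finset.set0.
  by apply: contraNneq t0 => E; move: tt'; rewrite E finset.subset0.
have [_] := J_join t0 (leq_trans (subset_leq_card tt') t'k); apply.
have [ub _] := J_join t'0 t'k => y /In_mem/mapP[v vt ->]; apply: ub.
apply/In_mem/mapP; exists v => //; move: vt; rewrite !mem_enum.
exact: (fintype.subsetP tt').
Qed.

(** At such a point all [pv v] with [v] in [t] lie in the support of [f] at the radial projection.
    This is a chain, so a maximum exists. *)
Let M_supp t x : ball_cl x -> 0 < ext_weight (inr (inl t)) x ->
  exists2 v, v \in t & M t = pv v /\ forall w, w \in t -> le (pv w) (M t).
Proof.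
move=> Bx /weightM_gt0[t0 [_ q4] _ lt _]; apply: M_max.
have [v0 v0t] := set0Pn _ t0.
have [||u /mapP[v vt ->] H] := @chain_max T le [seq pv v | v <- enum t] le_poset.
- apply: contraTneq v0t => /(congr1 size); rewrite size_map -cardE => /eqP.
  by rewrite cards_eq0 => /eqP ->; rewrite inE.
- have qx : 0 < sqnorm x by apply: lt_trans q4; lra.
  move=> _ _ /mapP[v vt ->] /mapP[w wt ->].
  apply: (realization_supp_chain (f_sphere (radial_proj_sphere qx))).
    by apply: pv_star => //; apply: lt; rewrite mem_enum in vt.
  by apply: pv_star => //; apply: lt; rewrite mem_enum in wt.
exists v; first by rewrite mem_enum in vt.
by move=> w wt; apply: H; apply: map_f; rewrite mem_enum.
Qed.

(** Values of [lam] exceed [lvl x] on [t] and are below it off [t'], so [t] is contained in [t'].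
    Hence [M t'] bounds every atom [av v] with [v] in [t], and [J t] is their least upper bound. *)
Let J_le_M t t' x : ball_cl x -> 0 < ext_weight (inr (inr t)) x ->
  0 < ext_weight (inr (inl t')) x -> le (J t) (M t').
Proof.
case: (le_poset) => _ _ trans.
move=> Bx /weightJ_gt0[t0 _ _ tl] /[dup] wM /weightM_gt0[_ [_ q4] _ _ t'l].
have [_ _ [_ Mub]] := M_supp Bx wM.
have tk : (#|t| <= k)%N.
  by apply: (@lam_mult x) => v /tl; apply: le_lt_trans; exact: pos_ge0.
have [_] := J_join t0 tk; apply=> y /In_mem/mapP[v vt ->].
apply: trans (av_pv v) (Mub v _); apply: contrapT => /negP vt'.
have ql : sqnorm x - 1/4 <= lvl x by rewrite /lvl /pos le_max lexx orbT.
have vl : lvl x < lam v x by apply: tl; rewrite mem_enum in vt.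
by have := lt_trans (lt_le_trans (t'l v vt') ql) vl; rewrite ltxx.
Qed.

(** Elements not of the form [J t] lie in the support of [f] at the radial projection; the [J t] are
    nested and lie below the active [M t']. *)
Lemma ext_weight_chain x i j : ball_cl x -> 0 < ext_weight i x ->
  0 < ext_weight j x -> le (ext_elt i) (ext_elt j) \/ le (ext_elt j) (ext_elt i).
Proof.
move=> Bx.
have nonJ a : (forall t, a <> inr (inr t)) -> 0 < ext_weight a x ->
    0 < sqnorm x /\ f (radial_proj x) (ext_elt a) != 0.
  case: a => [p _|[t _ wM|t /(_ t)//]].
    rewrite /= mulr_ge0_gt0 ?pos_ge0 // pos_gt0 => /andP[_ /cone_coord_gt0].
    by [].
  have [v vt [/= -> _]] := M_supp Bx wM.
  have [_ [_ q4] _ lt _] /= := (weightM_gt0 _ _).1 wM.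
  by split; [lra|apply: pv_star => //; exact: lt].
have isJ (a : 'I_(size F) + ({set V} + {set V})) :
    (exists t, a = inr (inr t)) \/ (forall t, a <> inr (inr t)).
  by case: a => [p|[t|t]]; [right|right|left; exists t].
have JJ t t' : 0 < ext_weight (inr (inr t)) x -> t \subset t' ->
    0 < ext_weight (inr (inr t')) x -> le (J t) (J t').
  move=> /weightJ_gt0[t0 _ _ _] tt' /weightJ_gt0[_ _ _ lt'].
  apply: J_mono => //; apply: (@lam_mult x) => v /lt'.
  by apply: le_lt_trans; exact: pos_ge0.
have Jn t a : (forall t, a <> inr (inr t)) -> 0 < ext_weight (inr (inr t)) x ->
    0 < ext_weight a x -> le (J t) (ext_elt a).
  case: a => [p _|[t' _|t' /(_ t')//]]; last exact: J_le_M.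
  (* The weights of [J] live where [sqnorm x] is below 1/2 and those of [f] where it is above, so
     they never meet. *)
  move=> /weightJ_gt0[_ q2 _ _]; rewrite /= mulr_ge0_gt0 ?pos_ge0 //.
  by rewrite pos_gt0 subr_gt0 => /andP[/(lt_trans q2)]; rewrite ltxx.
have [[t ->]|ni] := isJ i; have [[t' ->]|nj] := isJ j; move=> wi wj.
- have /weightJ_gt0[_ _ s _] := wi; have /weightJ_gt0[_ _ s' _] := wj.
  by have [tt'|tt'] := superlevel_comparable s s'; [left|right]; exact: JJ.
- by left; exact: Jn.
- by right; exact: Jn.
have [qx fi] := nonJ i ni wi; have [_ fj] := nonJ j nj wj.
exact: (realization_supp_chain (f_sphere (radial_proj_sphere qx))).
Qed.

Lemma ext_weight_cont i : continuous (ext_weight i).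
Proof.
have cq : continuous (@sqnorm m) by exact: sqnorm_continuous.
have cqb (b : RR) : continuous (fun x : 'rV[RR]_m => pos (sqnorm x - b)).
  by apply/continuous_pos/continuous_add => //; exact: continuous_const.
have cbq (b : RR) : continuous (fun x : 'rV[RR]_m => pos (b - sqnorm x)).
  by apply/continuous_pos/continuous_add; [exact: continuous_const|exact: continuous_opp].
have cl : continuous lvl by exact: cqb.
have cs t : continuous (sep t).
  apply: continuous_prod => v _; apply: continuous_prod => w _.
  by apply/continuous_pos/continuous_add => //; exact: continuous_opp.
case: i => [p|[t|t]] /=; first by apply: continuous_mul.
  apply: continuous_mul; first exact: continuous_const.
  do 3!apply: continuous_mul => //; apply: continuous_mul.
    by apply: continuous_prod.
  apply: continuous_prod => w _; apply/continuous_pos/continuous_add => //.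
  exact: continuous_opp.
apply: continuous_mul; first exact: continuous_const.
do 2!apply: continuous_mul => //.
apply: continuous_prod => w _; apply/continuous_pos/continuous_add => //.
exact: continuous_opp.
Qed.

Lemma cone_sum x : 0 < sqnorm x ->
  \sum_(i < size F) f (radial_proj x) (tnth (in_tuple F) i) = 1.
Proof.
move=> qx; rewrite -(big_tnth _ _ _ xpredT (f (radial_proj x))).
apply: (realization_sum (f_sphere (radial_proj_sphere qx))) => //.
exact/F_supp/radial_proj_sphere.
Qed.

Lemma ext_weight_pos x : ball_cl x -> exists i, 0 < ext_weight i x.
Proof.
move=> Bx; have [q1|q1] := eqVneq (sqnorm x) 1.
  have : \sum_(i < size F) f (radial_proj x) (tnth (in_tuple F) i) != 0.
    by rewrite cone_sum ?q1 ?oner_neq0.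
  move=> H; have [i fi] : exists i, f (radial_proj x) (tnth (in_tuple F) i) != 0.
    apply: contrapT => /forallNP fi; move/eqP: H; apply; apply: big1 => i _.
    by apply/eqP/negPn/negP; exact: fi.
  exists (inl i); rewrite /= mulr_gt0 ?pos_gt0 ?q1 //; first lra.
  by rewrite lt0r cone_ge0 andbT /cone_coord q1 mul1r.
have {}q1 : sqnorm x < 1 by rewrite lt_neqAle q1.
(* The set of all active vertices is a superlevel set; it serves [M] when [sqnorm x] exceeds 1/4 and
   [J] otherwise, where [lvl x] is 0. *)
pose t := finset (fun v => 0 < lam v x).
have t0 : t != finset.set0.
  by have [v vx] := lam_cover Bx; apply/set0Pn; exists v; rewrite inE.
have tN w : w \notin t -> lam w x = 0.
  by rewrite inE lt0r lam_ge0 andbT negbK => /eqP.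
have tP v w : v \in t -> w \notin t -> lam w x < lam v x.
  by rewrite inE => vt /tN ->.
have [q4|q4] := ltP (1/4) (sqnorm x).
  exists (inr (inl t)); apply/weightM_gt0; split=> // [v|w /tN ->].
    by rewrite inE.
  by rewrite subr_gt0.
exists (inr (inr t)); apply/weightJ_gt0; split=> // [|v]; first lra.
by rewrite inE /lvl /pos max_l // subr_le0.
Qed.

(** On the sphere only the weights of [f] survive, all scaled by 1/2, and normalising removes this
    factor. *)
Lemma ext_sphere x q : sphere x -> family_map ext_elt ext_weight x q = f x q.
Proof.
move=> Sx; have q1 : sqnorm x = 1 by [].
have E i : ext_weight i x = if i is inl p then f x (tnth (in_tuple F) p) / 2 else 0.
  case: i => [p|[t|t]] /=; rewrite q1.
  - rewrite /cone_coord q1 !mul1r radial_proj_id // mulrC.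
    have -> : pos (1 - 2^-1) = 2^-1 :> RR by rewrite /pos max_r; lra.
    by [].
  - by rewrite /pos subrr maxxx mul0r mulr0.
  - by rewrite /pos max_l ?mul0r ?mulr0 //; lra.
have S (P : pred ('I_(size F) + ({set V} + {set V}))) :
    \sum_(i | P i) ext_weight i x =
    (\sum_(p < size F | P (inl p)) f x (tnth (in_tuple F) p)) / 2.
  rewrite big_sumType /= [X in _ + X]big1 ?addr0; last by move=> i _; exact: (E (inr i)).
  by rewrite mulr_suml; apply: eq_bigr => p _; exact: (E (inl p)).
rewrite /family_map !S /=.
have := @cone_sum x; rewrite radial_proj_id // q1 => -> //.
rewrite -(big_tnth _ _ _ (fun p => p == q) (f x)).
have -> : \sum_(p <- F | p == q) f x p = f x q; last by field.
rewrite -big_filter; have [qF|qF] := boolP (q \in F).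
  by rewrite filter_pred1_uniq // big_seq1.
rewrite (_ : [seq i <- F | i == q] = [::]); last first.
  by apply/eqP; rewrite -(negbK (_ == _)) -has_filter has_pred1.
rewrite big_nil; apply/esym; apply: contrapT => /F_supp - /(_ Sx)/In_mem.
exact/negP.
Qed.

Lemma sphere_map_extends : exists g, cont_into_realization le (@ball_cl m) g /\
  forall x, sphere x -> g x = f x.
Proof.
exists (family_map ext_elt ext_weight); split.
  apply: family_map_cont.
  - exact: ext_weight_cont.
  - by move=> i x _; exact: ext_weight_ge0.
  - exact: ext_weight_pos.
  - exact: ext_weight_chain.
by move=> x Sx; apply/funext => q; exact: ext_sphere.
Qed.

End Extension.

(** * Connectivity of atomized posets *)

Theorem atomized_connected (T : choiceType) (le : T -> T -> Prop) (k : nat) :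
  is_poset le -> atomized le -> (1 <= k)%N ->
  (forall s : seq T, (size s <= k)%N -> ~ generates_poset le s) ->
  realization_connected le (k%:Z - 2).
Proof.
move=> po [atom_below joins] k1 nogen m mk f cf.
(* This makes the multiplicity [m + 1] of the bumps at most [k]. *)
have {}mk : (m < k)%N by move: mk; lia.
(* The empty set does not generate, so the poset has an element [t0]; it also serves as default
   value in the choices below. *)
have [t0 _] : exists u : T, upper_bound le [::] u.
  by apply: contrapT => H; apply: (nogen [::]) => //; split.
have [F uF Fs] := sphere_map_finite_support cf.
pose h (i : 'I_(size F)) := cone_coord f (tnth (in_tuple F) i).
have [i|x /= /andP[q4 _]|d d0 dP] := lebesgue_pos (h := h) (@annulus_compact m (1/4)).
- exact: (cone_coord_continuous cf).
- have qx : 0 < sqnorm x by lra.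
  apply: contrapT => /forallNP H.
  have := cone_sum (fun x => cf.1 x) uF Fs qx; rewrite big1 => [/eqP|i _].
    by rewrite eq_sym oner_eq0.
  apply/eqP/negPn/negP => fi; apply: (H i); rewrite /h lt0r (cone_coord_ge0 cf) andbT //.
  by rewrite mulf_neq0 // gt_eqF.
(* Bump supports have width below [2 / N] in each coordinate, hence below the Lebesgue number
   [d]. *)
have [N dN] : exists N : nat, 2 <= N%:R * d.
  exists (Num.bound (2 / d)); rewrite -ler_pdivrMr //.
  by apply/ltW/archi_boundP; rewrite divr_ge0 // ltW.
have close v (x y : 'rV[RR]_m) : 0 < @grid_bump m N v x -> 0 < grid_bump v y ->
    forall j, `|x ord0 j - y ord0 j| < d.
  move=> vx vy j; have := grid_bump_local j vx vy => H.
  have N0 : 0 < N%:R :> RR.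
    by rewrite lt0r ler0n andbT; apply/eqP => N0; move: dN; rewrite N0; lra.
  by rewrite -(ltr_pM2l N0); exact: lt_le_trans dN.
have /choice[pv pvP] : forall v : {ffun 'I_m -> 'I_(N.*2.+1)}, exists p : T,
    forall y, ball_cl y -> 1/4 < sqnorm y -> 0 < grid_bump v y -> f (radial_proj y) p != 0.
  (* If the bump is positive somewhere on the annulus, one cone coordinate is positive wherever the
     bump is; otherwise any element will do. *)
  move=> v; have [[x Kx vx]|nx] := pselect (exists2 x, 1/4 <= sqnorm x <= 1 & 0 < grid_bump v x).
    have [i hi] := dP x Kx; exists (tnth (in_tuple F) i) => y By q4 vy.
    by have /cone_coord_gt0[_] := hi y (close v x y vx vy).
  by exists t0 => y By q4 vy; case: nx; exists y => //; apply/andP; split=> //; exact: ltW.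
have /choice[av avP] v : exists a, minimal le a /\ le a (pv v) by exact: atom_below.
have /choice[J JP] : forall t : {set {ffun 'I_m -> 'I_(N.*2.+1)}}, exists j,
    t != finset.set0 -> (#|t| <= k)%N -> is_join le [seq av v | v <- enum t] j.
  move=> t; have [t0'|t0'] := eqVneq t finset.set0; first by exists t0.
  have [tk|tk] := leqP #|t| k; last by exists t0.
  have amin a : List.In a [seq av v | v <- enum t] -> minimal le a.
    by move=> /In_mem/mapP[v _ ->]; case: (avP v).
  have [|||j jP] := joins [seq av v | v <- enum t]; last by exists j.
  - move=> /(congr1 size)/=; rewrite size_map -cardE => /eqP.
    by rewrite cards_eq0; exact/negP.
  - exact: amin.
  - apply: contrapT => nub; apply: (nogen [seq av v | v <- enum t]) => //.
    by rewrite size_map -cardE.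
have /choice[M MP] : forall t : {set {ffun 'I_m -> 'I_(N.*2.+1)}}, exists u,
    (exists2 v, v \in t & forall w, w \in t -> le (pv w) (pv v)) ->
    exists2 v, v \in t & u = pv v /\ forall w, w \in t -> le (pv w) u.
  move=> t; have [[v vt H]|] := pselect (exists2 v, v \in t &
      forall w, w \in t -> le (pv w) (pv v)).
    by exists (pv v) => _; exists v.
  by exists t0.
apply: (@sphere_map_extends T le m k _ po f _ F uF Fs _ _ (@grid_bump m N)
  _ _ _ _ pv av _ _ J M JP MP).
- by move=> x; exact: cf.1.
- by move=> p; exact: (cone_coord_continuous cf).
- by move=> p x; exact: (cone_coord_ge0 cf).
- exact: grid_bump_continuous.
- exact: grid_bump_ge0.
- exact: grid_bump_cover.
- by move=> x s H; exact: leq_trans (grid_bump_mult H) mk.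
- by move=> v x Bx q4 vx; exact: pvP.
- by move=> v; case: (avP v).
Qed.

(** * Coset and subgroup posets *)

Lemma subset_poset (G : Type) (Q : set G -> Prop) :
  is_poset (fun A B : {C : set G | Q C} => proj1_sig A `<=` proj1_sig B).
Proof.
split=> [A //|A B AB BA|A B C AB BC]; last exact: subset_trans BC.
by apply: eq_sig_hprop => [? ? ?|]; [exact: Prop_irrelevance|exact/seteqP].
Qed.

Section Groups.
Variables (G : Type) (mul : G -> G -> G) (one : G) (inv : G -> G).
Hypothesis grp : is_group mul one inv.

Let mulA x y z : mul x (mul y z) = mul (mul x y) z.
Proof. by case: grp. Qed.
Let mul1 x : mul one x = x.
Proof. by case: grp. Qed.
Let mulx1 x : mul x one = x.
Proof. by case: grp. Qed.
Let mulV x : mul (inv x) x = one.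
Proof. by case: grp. Qed.
Let mulxV x : mul x (inv x) = one.
Proof. by case: grp. Qed.
Let mulK x y : mul x (mul (inv x) y) = y.
Proof. by rewrite mulA mulxV mul1. Qed.
Let mulVK x y : mul (inv x) (mul x y) = y.
Proof. by rewrite mulA mulV mul1. Qed.

Lemma inv_unique x y : mul x y = one -> y = inv x.
Proof. by move=> xy; rewrite -[y](mulVK x) xy mulx1. Qed.

Lemma inv_one : inv one = one.
Proof. by apply/esym/inv_unique; rewrite mul1. Qed.

Lemma trivial_subgroup : is_subgroup mul one inv [set one].
Proof.
by split=> [//|x y -> ->|x ->]; [exact: mul1|exact: inv_one].
Qed.

Lemma subgroup_bigcap (I : Type) (D : set I) (H : I -> set G) :
  (forall i, D i -> is_subgroup mul one inv (H i)) ->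
  is_subgroup mul one inv (\bigcap_(i in D) H i).
Proof.
move=> sH; split=> [i /sH[]//|x y Hx Hy i Di|x Hx i Di].
  by have [_ hM _] := sH i Di; apply: hM; [exact: Hx|exact: Hy].
by have [_ _ hV] := sH i Di; apply: hV; exact: Hx.
Qed.

Lemma not_generating (s : seq G) : ~ generates_group mul one inv s ->
  exists H, [/\ is_subgroup mul one inv H, H <> setT &
    forall x, List.In x s -> H x].
Proof.
move=> ng; apply: contrapT => nH; apply: ng => H sH Hs.
by apply: contrapT => HT; apply: nH; exists H.
Qed.

Definition coset (x : G) (H : set G) : set G := [set mul x h | h in H].

Lemma cosetP x H y : coset x H y <-> H (mul (inv x) y).
Proof.
split=> [[h Hh <-]|Hy]; first by rewrite mulVK.
by exists (mul (inv x) y); rewrite ?mulK.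
Qed.

Lemma coset_repr x y H : is_subgroup mul one inv H -> coset x H y ->
  coset x H = coset y H.
Proof.
move=> [_ HM HV] /cosetP xy; have yx : H (mul (inv y) x).
  suff -> : mul (inv y) x = inv (mul (inv x) y) by exact: HV.
  by apply: inv_unique; rewrite -mulA mulK mulV.
apply/seteqP; split=> z /cosetP Hz; apply/cosetP.
  by have := HM _ _ yx Hz; rewrite -mulA mulK.
by have := HM _ _ xy Hz; rewrite -mulA mulK.
Qed.

Lemma coset_trivial x : coset x [set one] = [set x].
Proof.
apply/seteqP; split=> [_ [h -> <-]|_ ->] /=; first by rewrite mulx1.
by exists one; rewrite ?mulx1.
Qed.

Local Notation cle := (@coset_le G mul one inv).
Local Notation cosets := (coset_poset mul one inv).

(** * The coset poset *)

Section CosetPoset.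
Hypothesis nontrivial : [set one] <> [set: G].

Let pointP x : is_proper_coset mul one inv [set x].
Proof.
by exists x, [set one]; split; [exact: trivial_subgroup| |rewrite -coset_trivial].
Qed.

Let point x : cosets := exist _ [set x] (pointP x).

Let point_below (C : cosets) x : proj1_sig C x -> cle (point x) C.
Proof. by move=> Cx y /= ->. Qed.

Let coset_nonempty (C : cosets) : exists x, proj1_sig C x.
Proof.
have [x [H [[H1 _ _] _ CE]]] := proj2_sig C; exists (mul x one).
by rewrite CE; exists one.
Qed.

Let minimal_point x : minimal cle (point x).
Proof.
move=> C Cx; have [_ anti _] := @subset_poset G (is_proper_coset mul one inv).
apply: anti => //; have [y Cy] := coset_nonempty C.
by have <- : y = x := Cx y Cy; exact: point_below.
Qed.

Let minimalP (C : cosets) : minimal cle C -> exists x, C = point x.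
Proof.
move=> Cmin; have [x Cx] := coset_nonempty C; exists x.
by apply/esym/Cmin/point_below.
Qed.

(** With [x] the point of the first atom, the join is [coset x K], where [K] is the intersection of
    all subgroups [H] such that [coset x H] contains every given atom. *)
Lemma coset_poset_atomized : atomized cle.
Proof.
split=> [C|s sN smin [u us]].
  have [x Cx] := coset_nonempty C; exists (point x).
  by split; [exact: minimal_point|exact: point_below].
case: s sN smin us => // a s _ smin us.
have [x ax] := minimalP (smin a (or_introl erefl)).
pose D (H : set G) := is_subgroup mul one inv H /\
  forall b, List.In b (a :: s) -> proj1_sig b `<=` coset x H.
(* Every upper bound contains [x], so [x] can be taken as its representative. *)
have ub_coset (C : cosets) : upper_bound cle (a :: s) C ->
    exists H, [/\ D H, H <> setT & proj1_sig C = coset x H].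
  have [y [H [sH HT CE]]] := proj2_sig C => ub.
  have Cx : proj1_sig C x by apply: (ub a) => /=; [left|rewrite ax].
  have CE' : proj1_sig C = coset x H by rewrite CE; apply: coset_repr => //; move: Cx; rewrite CE.
  by exists H; split=> //; split=> // b /ub; rewrite /coset_le CE'.
have [H0 [DH0 H0T _]] := ub_coset u us.
pose K := \bigcap_(H in D) H.
have sK : is_subgroup mul one inv K by apply: subgroup_bigcap => H [].
have KT : K <> setT.
  by move=> KE; apply: H0T; apply/seteqP; split=> // z _; apply: (_ : K z) => //; rewrite KE.
have jP : is_proper_coset mul one inv (coset x K) by exists x, K; split.
exists (exist _ _ jP : cosets); split=> [b bs z bz|C /ub_coset[H [DH _ CE]]].
  by apply/cosetP => H DH; apply/cosetP; exact: DH.2 bz.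
by rewrite /coset_le CE /= => z /cosetP Kz; apply/cosetP; exact: Kz.
Qed.

(** One atom is spent as the base point [x]; translating by [inv x] turns the other atoms into at
    most [k] group elements. *)
Lemma coset_poset_generation k :
  (forall s : seq G, (size s <= k)%N -> ~ generates_group mul one inv s) ->
  forall s : seq cosets, (size s <= k.+1)%N -> ~ generates_poset cle s.
Proof.
move=> ng s sk [smin]; apply; case: s sk smin => [_ _|a s sk smin].
  by exists (point one).
have [x ax] := minimalP (smin a (or_introl erefl)).
have /choice[r rP] : forall b : cosets, exists y, proj1_sig b y.
  exact: coset_nonempty.
have [|H [sH HT Hs]] := not_generating (ng [seq mul (inv x) (r b) | b <- s] _).
  by rewrite size_map.
have cP : is_proper_coset mul one inv (coset x H) by exists x, H.
exists (exist _ _ cP : cosets) => b /= [<- z|bs z].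
  rewrite ax => ->; apply/cosetP; rewrite mulV; by case: sH.
have [y bE] := minimalP (smin b (or_intror bs)).
have rb := rP b; move: rb; rewrite bE /= => ry ->; apply/cosetP.
by rewrite -ry -bE; apply: Hs; exact: (List.in_map (fun b => mul (inv x) (r b))).
Qed.

End CosetPoset.

Theorem coset_poset_connected k : (1 <= k)%N ->
  (forall s : seq G, (size s <= k)%N -> ~ generates_group mul one inv s) ->
  realization_connected cle (k%:Z - 1).
Proof.
move=> k1 ng; have ntriv : [set one] <> [set: G].
  move=> E; apply: (ng [::]) => // H [H1 _ _] _; apply/seteqP; split=> // x _.
  by have -> : x = one by have : [set one] x by rewrite E.
(* The bound [k + 1] on the number of atoms gains one degree of connectivity. *)
have -> : k%:Z - 1 = k.+1%:Z - 2 by lia.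
apply: (@atomized_connected {classic cosets} cle).
- exact: subset_poset.
- exact: coset_poset_atomized.
- by [].
- exact: coset_poset_generation.
Qed.

(** * Powers and elements of prime order *)

Lemma gpowD x a b : gpow mul one x (a + b) = mul (gpow mul one x a) (gpow mul one x b).
Proof. by rewrite /gpow; elim: a => [|a IH] /=; rewrite ?mul1 // IH mulA. Qed.

Lemma gpow1n n : gpow mul one one n = one.
Proof. by elim: n => //= n IH; rewrite /gpow /= -/(gpow mul one one n) IH mul1. Qed.

Lemma gpowM x a b : gpow mul one x (a * b) = gpow mul one (gpow mul one x a) b.
Proof.
elim: b => [|b IH]; first by rewrite muln0.
by rewrite mulnS gpowD IH.
Qed.

Lemma subgroup_gpow H x n : is_subgroup mul one inv H -> H x -> H (gpow mul one x n).
Proof. by case=> H1 HM _ Hx; elim: n => //= n IH; exact: HM. Qed.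

(** Natural exponents suffice: the inverse of the power [a] is the power [a * (p - 1)]. *)
Lemma gpow_subgroup p y : (0 < p)%N -> gpow mul one y p = one ->
  is_subgroup mul one inv [set gpow mul one y n | n in setT].
Proof.
move=> p0 yp; split; first by exists 0.
  by move=> _ _ [a _ <-] [b _ <-]; exists (a + b)%N => //; exact: gpowD.
move=> _ [a _ <-]; exists (a * p.-1)%N => //; apply: inv_unique.
by rewrite -gpowD -mulnS prednK // mulnC gpowM yp gpow1n.
Qed.

(** If [x] has order [n] and [p] is a prime divisor of [n], the power [n / p] has order [p]. *)
Lemma prime_order_power x : torsion mul one -> x <> one ->
  exists n, prime_order mul one (gpow mul one x n).
Proof.
move=> tors x1; have [n [n0 [xn nmin]]] := tors x.
have n1 : (1 < n)%N.
  by case: n n0 xn {nmin} => [|[|n]] // _; rewrite /gpow /= mulx1.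
have pp := pdiv_prime n1; have := pdiv_dvd n; set p := pdiv n in pp * => pn.
have p0 := prime_gt0 pp; have q0 : (0 < n %/ p)%N by rewrite divn_gt0 // dvdn_leq.
exists (n %/ p)%N, p; split=> //; split=> //; split; first by rewrite -gpowM divnK.
move=> j j0 jp; rewrite -gpowM; apply: nmin; first by rewrite muln_gt0 q0.
by rewrite -[ltnRHS](divnK pn) ltn_pmul2l.
Qed.

(** The exponent [n] is prime to [p], and a Bezout relation inverts it modulo [p]. *)
Lemma prime_order_generator y n p : prime p -> has_order mul one y p ->
  gpow mul one y n <> one -> exists c, gpow mul one (gpow mul one y n) c = y.
Proof.
move=> pp [p0 [yp _]] yn.
have cop : coprime n p.
  rewrite coprime_sym prime_coprime //; apply/negP => /dvdnP[c nE].
  by apply: yn; rewrite nE mulnC gpowM yp gpow1n.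
have n0 : (0 < n)%N by case: n yn {cop} => [[]|].
case: (egcdnP p n0) => a b E _; exists a; rewrite -gpowM mulnC E.
rewrite gpowD (eqP cop) mulnC gpowM yp gpow1n mul1.
by rewrite /gpow /= mulx1.
Qed.

Local Notation sle := (@subgroup_le G mul one inv).
Local Notation subgroups := (subgroup_poset mul one inv).

(** * The subgroup poset of a torsion group *)

Section SubgroupPoset.
Hypothesis tors : torsion mul one.

Let cyc y : set G := [set gpow mul one y n | n in setT].

Let cyc_self y : cyc y y.
Proof. by exists 1%N; rewrite //= /gpow /= mulx1. Qed.

Let cyc_min y H : is_subgroup mul one inv H -> H y -> cyc y `<=` H.
Proof. by move=> sH Hy _ [n _ <-]; exact: subgroup_gpow. Qed.

Let prime_order_neq1 y : prime_order mul one y -> y <> one.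
Proof.
move=> [p [pp [_ [_ ymin]]]] y1; apply: (ymin 1%N) => //; first exact: prime_gt1.
by rewrite /gpow /= mulx1.
Qed.

Let cyc_subgroup y : prime_order mul one y -> is_subgroup mul one inv (cyc y).
Proof. by move=> [p [_ [p0 [yp _]]]]; exact: gpow_subgroup p0 yp. Qed.

Let nontrivialP (H : set G) : is_subgroup mul one inv H -> H <> [set one] ->
  exists2 x, H x & x <> one.
Proof.
move=> [H1 _ _] HN; apply: contrapT => nx; apply: HN; apply/seteqP; split=> x.
  by move=> Hx; apply: contrapT => x1; apply: nx; exists x.
by move=> ->.
Qed.

Let subgroup_prime (H : subgroups) : exists2 y, proj1_sig H y & prime_order mul one y.
Proof.
case: H => H [sH HT HN] /=; have [x Hx x1] := nontrivialP sH HN.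
have [n xn] := prime_order_power tors x1.
by exists (gpow mul one x n) => //; exact: subgroup_gpow.
Qed.

(** Properness of [cyc y] comes from [H]. It is minimal because any nontrivial element of it has [y]
    as a power. *)
Let cyc_atom (H : subgroups) y : proj1_sig H y -> prime_order mul one y ->
  exists C : subgroups, [/\ proj1_sig C = cyc y, minimal sle C & sle C H].
Proof.
case: H => H HP /= Hy po; have [sH HT HN] := HP.
have cH := cyc_min sH Hy.
have cP : is_proper_nontrivial_subgroup mul one inv (cyc y).
  split; first exact: cyc_subgroup.
    by move=> E; apply: HT; apply/seteqP; split=> // z _; apply: cH; rewrite E.
  by move=> E; apply: (prime_order_neq1 po); have := cyc_self y; rewrite E.
exists (exist _ _ cP); split=> // D Dy.
have [_ anti _] := @subset_poset G (is_proper_nontrivial_subgroup mul one inv).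
apply: anti => //; have [sD DT DN] := proj2_sig D; have Dc : proj1_sig D `<=` cyc y by exact: Dy.
have [z Dz z1] := nontrivialP sD DN; have [n _ nz] := Dc z Dz.
have [p [pp yp]] := po; rewrite -nz in z1 Dz.
have [c cy] := prime_order_generator pp yp z1.
by apply: cyc_min => //; rewrite -cy; exact: subgroup_gpow.
Qed.

Lemma subgroup_poset_atomized : atomized sle.
Proof.
split=> [H|s sN smin [u us]].
  have [y Hy po] := subgroup_prime H.
  by have [C [_ ? ?]] := cyc_atom Hy po; exists C.
pose D (H : subgroups) := upper_bound sle s H.
pose K := \bigcap_(H in D) (proj1_sig H : set G).
have sK : is_subgroup mul one inv K.
  by apply: subgroup_bigcap => H _; case: (proj2_sig H).
have KP : is_proper_nontrivial_subgroup mul one inv K.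
  split=> // E.
    have [_ uT _] := proj2_sig u; apply: uT; apply/seteqP; split=> // z _.
    by apply: (_ : K z) => //; rewrite E.
  (* The intersection is nontrivial because it contains the first atom of the nonempty list. *)
  case: s @D @K sK E us sN smin => // a s D K sK E us _ smin.
  have [sa _ aN] := proj2_sig a; have [x ax x1] := nontrivialP sa aN.
  apply: x1; suff : K x by rewrite E.
  by move=> H DH; apply: (DH a) => //; left.
exists (exist _ _ KP : subgroups); split=> [a as_ x ax H DH|H DH x Kx].
  exact: (DH a).
exact: Kx.
Qed.

(** One element of prime order is chosen in each atom. A proper subgroup containing these elements
    contains the cyclic groups they generate, which by minimality are the atoms themselves. *)
Lemma subgroup_poset_generation k : (1 <= k)%N ->
  (forall s : seq G, (size s <= k)%N ->
    (forall x, List.In x s -> prime_order mul one x) ->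
    ~ generates_group mul one inv s) ->
  forall s : seq subgroups, (size s <= k)%N -> ~ generates_poset sle s.
Proof.
move=> k1 ng s sk [smin]; apply.
(* For the empty list an upper bound must still be nontrivial; adding [y0] ensures this and fits the
   bound since [k] is at least 1. *)
have [y0 po0] : exists y, prime_order mul one y.
  have [H [[H1 _ _] HT _]] := not_generating (ng [::] isT (fun x => False_ind _)).
  have [x x1] : exists x : G, x <> one.
    apply: contrapT => nx; apply: HT; apply/seteqP; split=> // x _.
    by have -> : x = one by apply: contrapT => x1; apply: nx; exists x.
  by have [n ?] := prime_order_power tors x1; exists (gpow mul one x n).
have /choice[r rP] : forall b : subgroups, exists y,
    proj1_sig b y /\ prime_order mul one y.
  by move=> b; have [y ? ?] := subgroup_prime b; exists y.
pose l := if s is [::] then [:: y0] else [seq r b | b <- s].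
have lk : (size l <= k)%N by rewrite /l; case: s sk {smin l} => // b s; rewrite size_map.
have lP x : List.In x l -> prime_order mul one x.
  rewrite /l; case: s {sk smin l lk} => [|b s]; first by case=> // <-.
  by move=> /(proj1 (List.in_map_iff r (b :: s) x))[c [<- _]]; case: (rP c).
have [H [sH HT Hl]] := not_generating (ng l lk lP).
have HP : is_proper_nontrivial_subgroup mul one inv H.
  split=> // E.
  have [x xl] : exists x, List.In x l.
    by rewrite /l; case: s {sk smin l lk lP Hl} => [|b s]; eexists; left.
  by apply: (prime_order_neq1 (lP x xl)); have := Hl x xl; rewrite E.
exists (exist _ _ HP : subgroups) => b bs.
have [br pr] := rP b; have [C [Cr _ Cb]] := cyc_atom br pr.
rewrite -(smin b bs C Cb) /subgroup_le Cr /=; apply: cyc_min => //; apply: Hl.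
rewrite /l; case: s bs {sk smin l lk lP} => // c s bs.
exact: (@List.in_map _ _ r (c :: s) b bs).
Qed.

End SubgroupPoset.

Theorem subgroup_poset_connected k : (1 <= k)%N -> torsion mul one ->
  (forall s : seq G, (size s <= k)%N ->
    (forall x, List.In x s -> prime_order mul one x) ->
    ~ generates_group mul one inv s) ->
  realization_connected sle (k%:Z - 2).
Proof.
move=> k1 tors ng; apply: (@atomized_connected {classic subgroups} sle) => //.
- exact: subset_poset.
- exact: subgroup_poset_atomized.
- exact: subgroup_poset_generation.
Qed.

End Groups.

Theorem mainTheorem1 :
  (forall (T : Type) (le : T -> T -> Prop) (k : nat),
     is_poset le -> atomized le -> (1 <= k)%N ->
     (forall s : seq T, (size s <= k)%N -> ~ generates_poset le s) ->
     realization_connected le (k%:Z - 2)) /\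
  (forall (G : Type) (mul : G -> G -> G) (one : G) (inv : G -> G) (k : nat),
     is_group mul one inv -> (1 <= k)%N ->
     (forall s : seq G, (size s <= k)%N -> ~ generates_group mul one inv s) ->
     realization_connected (@coset_le G mul one inv) (k%:Z - 1)) /\
  (forall (G : Type) (mul : G -> G -> G) (one : G) (inv : G -> G) (k : nat),
     is_group mul one inv -> (1 <= k)%N -> torsion mul one ->
     (forall s : seq G, (size s <= k)%N ->
        (forall x, List.In x s -> prime_order mul one x) ->
        ~ generates_group mul one inv s) ->
     realization_connected (@subgroup_le G mul one inv) (k%:Z - 2)).
Proof.
split; last split.
(* Classically every type carries a choice structure. *)
- by move=> T le k; exact: (@atomized_connected {classic T} le k).
- by move=> G mul one inv k grp; exact: coset_poset_connected.
- by move=> G mul one inv k grp; exact: subgroup_poset_connected.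
Qed.
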